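(* Let $R$ be a commutative ring with identity, let $M_1, M_2, N$ be $R$-modules, and let $f_i : M_i \to N$ ($i=1,2$) be $R$-linear maps. Let $S$ be an $R$-algebra with structural morphism $\rho:R\to S$. If $S$ is a flat $R$-algebra, then $$\rho^{\ast}(\ker(f_1\mid f_2))=\ker(\rho^{\ast}(f_1)\mid\rho^{\ast}(f_2)).$$
   Context: For $R$-linear maps $f_1:M_1\to N$ and $f_2:M_2\to N$, the kernel of the pair is the $R$-submodule of $M_2$ given by $\ker(f_1\mid f_2)=\{m_2\in M_2 \mid \exists m_1\in M_1 : f_1(m_1)+f_2(m_2)=0\}$; the same definition is used over $S$. For an $R$-module $M$, $\rho^{\ast}(M)=M\otimes_R S$, and for an $R$-linear map $f:M\to N$, $\rho^{\ast}(f)=f\otimes\mathbf{I}_S:M\otimes_R S\to N\otimes_R S$. Since $S$ is flat, $\ker(f_1\mid f_2)\otimes_R S$ is identified with its image in $M_2\otimes_R S$ under the map induced by the inclusion $\ker(f_1\mid f_2)\subseteq M_2$; the equality is understood under this identification, as $S$-submodules of $M_2\otimes_R S$. *)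

(* Defs.v *)
From HB Require Import structures.
From mathcomp Require Import all_boot all_algebra.
From mathcomp Require Import boolp classical_sets.

Set Implicit Arguments.
Unset Strict Implicit.
Unset Printing Implicit Defensive.

Import GRing.Theory.
Local Open Scope ring_scope.
Local Open Scope quotient_scope.
Local Open Scope classical_set_scope.

(* All rings below may be trivial, hence the pzRingType structures. *)

Section Tensor.
Context {R : comPzRingType} (M N : lmodType R).

(* The sequence [:: (m1, n1); ...; (mk, nk)] stands for the formal sum of the
   mi (x) ni. tensor_rel is the least congruence of commutative monoids for
   which (x) is biadditive and R-balanced. The quotient monoid is already a
   group, the opposite of m (x) n being (- m) (x) n. *)
Inductive tensor_rel : seq (M * N) -> seq (M * N) -> Prop :=
| tensor_rel_refl s : tensor_rel s s
| tensor_rel_sym s t : tensor_rel s t -> tensor_rel t s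
| tensor_rel_trans t s u : tensor_rel s t -> tensor_rel t u -> tensor_rel s u
| tensor_rel_cat s s' t t' :
    tensor_rel s s' -> tensor_rel t t' -> tensor_rel (s ++ t) (s' ++ t')
| tensor_rel_comm s t : tensor_rel (s ++ t) (t ++ s)
| tensor_rel_0l n : tensor_rel [:: (0, n)] [::]
| tensor_rel_Dl m m' n : tensor_rel [:: (m + m', n)] [:: (m, n); (m', n)]
| tensor_rel_Dr m n n' : tensor_rel [:: (m, n + n')] [:: (m, n); (m, n')]
| tensor_rel_Z (r : R) m n : tensor_rel [:: (r *: m, n)] [:: (m, r *: n)].

Definition tensor_relb : rel (seq (M * N)) := fun s t => `[< tensor_rel s t >].

Lemma tensor_relb_refl : reflexive tensor_relb.
Proof. by move=> s; apply/asboolP; exact: tensor_rel_refl. Qed.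

Lemma tensor_relb_sym : symmetric tensor_relb.
Proof. by move=> s t; apply/asboolP/asboolP; exact: tensor_rel_sym. Qed.

Lemma tensor_relb_trans : transitive tensor_relb.
Proof.
by move=> t s u /asboolP st /asboolP tu; apply/asboolP/(tensor_rel_trans st tu).
Qed.

Canonical tensor_equiv :=
  EquivRel tensor_relb tensor_relb_refl tensor_relb_sym tensor_relb_trans.

Definition tensor : Type := {eq_quot tensor_equiv}.

HB.instance Definition _ := Choice.on tensor.

Definition tensor_class (s : seq (M * N)) : tensor := \pi_({eq_quot tensor_equiv}) s.

Definition tensor_repr (x : tensor) : seq (M * N) :=
  repr (x : {eq_quot tensor_equiv}).

Lemma tensor_reprK x : tensor_class (tensor_repr x) = x.
Proof. exact: reprK. Qed.

Lemma tensor_classP s t : tensor_class s = tensor_class t <-> tensor_rel s t.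
Proof.
split=> [/eqquotP/asboolP//|st].
by apply/eqquotP/asboolP.
Qed.

Lemma tensor_repr_class s : tensor_rel (tensor_repr (tensor_class s)) s.
Proof. by apply/tensor_classP; rewrite tensor_reprK. Qed.

Definition pure (m : M) (n : N) : tensor := tensor_class [:: (m, n)].

Definition tensor_add (x y : tensor) :=
  tensor_class (tensor_repr x ++ tensor_repr y).

Lemma tensor_add_class s t :
  tensor_add (tensor_class s) (tensor_class t) = tensor_class (s ++ t).
Proof. by apply/tensor_classP/tensor_rel_cat; exact: tensor_repr_class. Qed.

Definition tensor_opp (x : tensor) :=
  tensor_class [seq (- p.1, p.2) | p <- tensor_repr x].

Lemma tensor_addA : associative tensor_add.
Proof.
move=> x y z; rewrite -(tensor_reprK x) -(tensor_reprK y) -(tensor_reprK z).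
by rewrite !tensor_add_class catA.
Qed.

Lemma tensor_addC : commutative tensor_add.
Proof. by move=> x y; apply/tensor_classP/tensor_rel_comm. Qed.

Lemma tensor_add0 : left_id (tensor_class [::]) tensor_add.
Proof. by move=> x; rewrite -(tensor_reprK x) tensor_add_class. Qed.

Lemma tensor_addN : left_inverse (tensor_class [::]) tensor_opp tensor_add.
Proof.
move=> x; rewrite -[X in tensor_add _ X]tensor_reprK /tensor_opp tensor_add_class.
apply/tensor_classP; elim: (tensor_repr x) => [|[m n] s IH] /=.
  exact: tensor_rel_refl.
have mn0 : tensor_rel [:: (- m, n); (m, n)] [::].
  apply: tensor_rel_trans (tensor_rel_0l n).
  by rewrite -(addNr m); apply/tensor_rel_sym/tensor_rel_Dl.
rewrite -cat1s -[(m, n) :: s]cat1s.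
set t := map _ s.
apply: (tensor_rel_trans (t := [:: (- m, n)] ++ ([:: (m, n)] ++ (t ++ s)))).
  apply: tensor_rel_cat; first exact: tensor_rel_refl.
  rewrite !catA; apply: tensor_rel_cat; last exact: tensor_rel_refl.
  exact: tensor_rel_comm.
by rewrite catA; exact: (tensor_rel_cat mn0 IH).
Qed.

HB.instance Definition _ := GRing.isZmodule.Build tensor
  tensor_addA tensor_addC tensor_add0 tensor_addN.

Lemma tensor_classD s t :
  tensor_class (s ++ t) = tensor_class s + tensor_class t.
Proof. by rewrite -tensor_add_class. Qed.

Lemma tensor_class_sum s : tensor_class s = \sum_(p <- s) pure p.1 p.2.
Proof.
elim: s => [|[m n] s IH]; first by rewrite big_nil.
by rewrite big_cons -cat1s tensor_classD IH.
Qed.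

Lemma tensor_sum x : exists s : seq (M * N), x = \sum_(p <- s) pure p.1 p.2.
Proof. by exists (tensor_repr x); rewrite -tensor_class_sum tensor_reprK. Qed.

Lemma tensor_ind (P : tensor -> Prop) :
  P 0 -> (forall m n x, P x -> P (pure m n + x)) -> forall x, P x.
Proof.
move=> P0 PD x; have [s ->] := tensor_sum x.
by elim: s => [|p s IH]; rewrite ?big_nil ?big_cons //; exact: PD.
Qed.

Lemma pureDl m m' n : pure (m + m') n = pure m n + pure m' n.
Proof.
by rewrite -tensor_classD; apply/tensor_classP/tensor_rel_Dl.
Qed.

Lemma pureDr m n n' : pure m (n + n') = pure m n + pure m n'.
Proof.
by rewrite -tensor_classD; apply/tensor_classP/tensor_rel_Dr.
Qed.

Lemma pure0l n : pure 0 n = 0.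
Proof. by apply/tensor_classP/tensor_rel_0l. Qed.

Lemma pureZ_balanced r m n : pure (r *: m) n = pure m (r *: n).
Proof. by apply/tensor_classP/tensor_rel_Z. Qed.

Lemma pure0r m : pure m 0 = 0.
Proof. by rewrite -(scale0r 0) -pureZ_balanced scale0r pure0l. Qed.

(* The group morphism induced by a biadditive balanced map; junk otherwise. *)
Definition tensor_lift (V : zmodType) (b : M -> N -> V) (x : tensor) : V :=
  \sum_(p <- tensor_repr x) b p.1 p.2.

Definition balanced (V : zmodType) (b : M -> N -> V) :=
  [/\ forall m m' n, b (m + m') n = b m n + b m' n,
      forall m n n', b m (n + n') = b m n + b m n'
    & forall (r : R) m n, b (r *: m) n = b m (r *: n)].

Section Lift.
Context (V : zmodType) (b : M -> N -> V) (bb : balanced b).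

Lemma tensor_lift_class s :
  tensor_lift b (tensor_class s) = \sum_(p <- s) b p.1 p.2.
Proof.
case: bb => bDl bDr bZ; rewrite /tensor_lift.
have := tensor_repr_class s; move: (tensor_repr _) => s' ss'.
elim: {s' s}ss' => /=.
- by [].
- by move=> s t _ ->.
- by move=> t s u _ -> _ ->.
- by move=> s s' t t' _ h _ h'; rewrite !big_cat /= h h'.
- by move=> s t; rewrite !big_cat /= addrC.
- move=> n; rewrite big_seq1 big_nil /=.
  by apply: (addrI (b 0 n)); rewrite -bDl !addr0.
- by move=> m m' n; rewrite !big_cons !big_nil /= !addr0 bDl.
- by move=> m n n'; rewrite !big_cons !big_nil /= !addr0 bDr.
- by move=> r m n; rewrite !big_seq1 /= bZ.
Qed.

Lemma tensor_lift_pure m n : tensor_lift b (pure m n) = b m n.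
Proof. by rewrite tensor_lift_class big_seq1. Qed.

Lemma tensor_liftD : {morph tensor_lift b : x y / x + y}.
Proof.
move=> x y; rewrite -(tensor_reprK x) -(tensor_reprK y) -tensor_classD.
by rewrite !tensor_lift_class big_cat.
Qed.

Lemma tensor_lift0 : tensor_lift b 0 = 0.
Proof. by rewrite -[0]/(tensor_class [::]) tensor_lift_class big_nil. Qed.

End Lift.

Lemma tensor_ext (V : zmodType) (h h' : tensor -> V) :
    {morph h : x y / x + y} -> {morph h' : x y / x + y} ->
    (forall m n, h (pure m n) = h' (pure m n)) -> h =1 h'.
Proof.
have h0 (g : tensor -> V) : {morph g : x y / x + y} -> g 0 = 0.
  by move=> gD; apply: (addrI (g 0)); rewrite -gD !addr0.
move=> hD hD' hE; elim/tensor_ind => [|m n x IH]; first by rewrite !h0.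
by rewrite hD hD' hE IH.
Qed.

Definition tensor_scale (r : R) : tensor -> tensor :=
  tensor_lift (fun m n => pure (r *: m) n).

Lemma tensor_scale_balanced r : balanced (fun m n => pure (r *: m) n).
Proof.
split=> [m m' n|m n n'|r' m n]; first by rewrite scalerDr pureDl.
- by rewrite pureDr.
- by rewrite scalerA mulrC -scalerA pureZ_balanced.
Qed.

Lemma tensor_scale_pure r m n : tensor_scale r (pure m n) = pure (r *: m) n.
Proof. exact/tensor_lift_pure/tensor_scale_balanced. Qed.

Lemma tensor_scaleD r : {morph tensor_scale r : x y / x + y}.
Proof. exact/tensor_liftD/tensor_scale_balanced. Qed.

Lemma tensor_scaleA a b x :
  tensor_scale a (tensor_scale b x) = tensor_scale (a * b) x.
Proof.
move: x; apply: tensor_ext => [x y|x y|m n]; rewrite ?tensor_scaleD //.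
by rewrite !tensor_scale_pure scalerA.
Qed.

Lemma tensor_scale1 : left_id 1 tensor_scale.
Proof.
apply: tensor_ext => [x y|//|m n]; first exact: tensor_scaleD.
by rewrite tensor_scale_pure scale1r.
Qed.

Lemma tensor_scaleDr : right_distributive tensor_scale +%R.
Proof. exact: tensor_scaleD. Qed.

Lemma tensor_scaleDl x : {morph tensor_scale^~ x : a b / a + b}.
Proof.
move=> a b; move: x; apply: tensor_ext => [x y|x y|m n] /=.
- exact: tensor_scaleD.
- by rewrite !tensor_scaleD addrACA.
- by rewrite !tensor_scale_pure scalerDl pureDl.
Qed.

HB.instance Definition _ := GRing.Zmodule_isLmodule.Build R tensor
  tensor_scaleA tensor_scale1 tensor_scaleDr tensor_scaleDl.

Lemma pureZl r m n : pure (r *: m) n = r *: pure m n.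
Proof. by rewrite -tensor_scale_pure. Qed.

Lemma pureZr r m n : pure m (r *: n) = r *: pure m n.
Proof. by rewrite -pureZ_balanced pureZl. Qed.

Lemma tensor_universal (V : lmodType R) (b : M -> N -> V) :
    (forall n, linear (b^~ n)) -> (forall m, linear (b m)) ->
  exists2 h : {linear tensor -> V}, (forall m n, h (pure m n) = b m n)
    & forall h' : {linear tensor -> V},
        (forall m n, h' (pure m n) = b m n) -> h' =1 h.
Proof.
move=> bl br.
have bZ0l r m n : b (r *: m) n = r *: b m n.
  have b0 : b 0 n = 0.
    have := bl n 1 0 0; rewrite !scale1r addr0 => e.
    by apply: (addrI (b 0 n)); rewrite addr0 -e.
  by have := bl n r m 0; rewrite !addr0 b0 addr0.
have bZ0r r m n : b m (r *: n) = r *: b m n.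
  have b0 : b m 0 = 0.
    have := br m 1 0 0; rewrite !scale1r addr0 => e.
    by apply: (addrI (b m 0)); rewrite addr0 -e.
  by have := br m r n 0; rewrite !addr0 b0 addr0.
have bb : balanced b.
  split=> [m m' n|m n n'|r m n]; last by rewrite bZ0l bZ0r.
  - by have := bl n 1 m m'; rewrite !scale1r.
  - by have := br m 1 n n'; rewrite !scale1r.
have hlin : linear (tensor_lift b).
  move=> r x y; rewrite (tensor_liftD bb); congr (_ + _).
  move: x; apply: tensor_ext => [x x'|x x'|m n].
  - by rewrite scalerDr (tensor_liftD bb).
  - by rewrite (tensor_liftD bb) scalerDr.
  - by rewrite -pureZl !(tensor_lift_pure bb).
pose hL := GRing.isLinear.Build R tensor V *:%R (tensor_lift b) hlin.
pose h : {linear tensor -> V} := HB.pack (tensor_lift b) hL.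
exists h => [m n|h' h'E]; first exact: tensor_lift_pure bb m n.
apply: tensor_ext; [exact: raddfD | exact: raddfD |] => m n.
by rewrite h'E; exact/esym/(tensor_lift_pure bb).
Qed.

End Tensor.

Arguments tensor_rel {R M N} s t.
Arguments pure {R M N} m n.

Section TensorMap.
Context {R : comPzRingType} {M M' N N' : lmodType R}.
Context (f : {linear M -> M'}) (g : {linear N -> N'}).

Definition tensor_map : tensor M N -> tensor M' N' :=
  tensor_lift (fun m n => pure (f m) (g n)).

Lemma tensor_map_balanced : balanced (fun m n => pure (f m) (g n)).
Proof.
split=> [m m' n|m n n'|r m n]; first by rewrite linearD pureDl.
- by rewrite linearD pureDr.
- by rewrite !linearZ pureZ_balanced.
Qed.

Lemma tensor_map_pure m n : tensor_map (pure m n) = pure (f m) (g n).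
Proof. exact/tensor_lift_pure/tensor_map_balanced. Qed.

Lemma tensor_mapD : {morph tensor_map : x y / x + y}.
Proof. exact/tensor_liftD/tensor_map_balanced. Qed.

Lemma tensor_map_linear : linear tensor_map.
Proof.
move=> r x y; rewrite tensor_mapD; congr (_ + _).
move: x; apply: tensor_ext => [x x'|x x'|m n].
- by rewrite scalerDr tensor_mapD.
- by rewrite tensor_mapD scalerDr.
- by rewrite -pureZl !tensor_map_pure linearZ pureZl.
Qed.

HB.instance Definition _ :=
  GRing.isLinear.Build R (tensor M N) (tensor M' N') *:%R tensor_map
    tensor_map_linear.

End TensorMap.

Definition flat_module {R : comPzRingType} (P : lmodType R) : Prop :=
  forall (A B : lmodType R) (g : {linear A -> B}),
    injective g -> injective (tensor_map g (idfun : {linear P -> P})).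

(* The library's algType R only covers nontrivial algebras. *)
Record algebra (R : comPzRingType) := Algebra {
  alg_ring :> pzRingType;
  structural : {rmorphism R -> alg_ring};
  structural_central : forall (r : R) (s : alg_ring),
    structural r * s = s * structural r
}.

Section AlgebraModule.
Context {R : comPzRingType} (S : algebra R).

Definition algmod : Type := S.

HB.instance Definition _ := GRing.Zmodule.on algmod.

Definition algmod_scale (r : R) (s : algmod) : algmod :=
  (structural S r * s : S).

Lemma algmod_scaleA a b s :
  algmod_scale a (algmod_scale b s) = algmod_scale (a * b) s.
Proof. by rewrite /algmod_scale rmorphM /= mulrA. Qed.

Lemma algmod_scale1 : left_id 1 algmod_scale.
Proof. by move=> s; rewrite /algmod_scale rmorph1 mul1r. Qed.

Lemma algmod_scaleDr : right_distributive algmod_scale +%R.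
Proof. by move=> r s t; exact: mulrDr. Qed.

Lemma algmod_scaleDl s : {morph algmod_scale^~ s : a b / a + b}.
Proof. by move=> a b; rewrite /algmod_scale rmorphD /=; exact: mulrDl. Qed.

HB.instance Definition _ := GRing.Zmodule_isLmodule.Build R algmod
  algmod_scaleA algmod_scale1 algmod_scaleDr algmod_scaleDl.

End AlgebraModule.

Definition flat_algebra {R : comPzRingType} (S : algebra R) : Prop :=
  flat_module (algmod S).

Section BaseChange.
Context {R : comPzRingType} (S : algebra R) (M : lmodType R).

Definition base_change : Type := tensor M (algmod S).

HB.instance Definition _ := GRing.Zmodule.on base_change.

Definition base_change_scale (a : S) : base_change -> base_change :=
  tensor_lift (fun (m : M) (s : algmod S) => pure m (a * s : algmod S)).

Lemma base_change_scale_balanced (a : S) :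
  balanced (fun (m : M) (s : algmod S) => pure m (a * s : algmod S)).
Proof.
split=> [m m' s|m s s'|r m s]; first by rewrite pureDl.
- by rewrite -pureDr; congr pure; exact: mulrDr.
- rewrite pureZ_balanced; congr pure; rewrite /GRing.scale /= /algmod_scale.
  by rewrite !mulrA structural_central.
Qed.

Lemma base_change_scale_pure a m (s : S) :
  base_change_scale a (pure m (s : algmod S)) = pure m (a * s : algmod S).
Proof. exact: (tensor_lift_pure (base_change_scale_balanced a)). Qed.

Lemma base_change_scaleD a : {morph base_change_scale a : x y / x + y}.
Proof. exact: (tensor_liftD (base_change_scale_balanced a)). Qed.

Lemma base_change_scaleA a b x :
  base_change_scale a (base_change_scale b x) = base_change_scale (a * b) x.
Proof.
move: x; apply: tensor_ext => [x y|x y|m s]; rewrite ?base_change_scaleD //.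
by rewrite !base_change_scale_pure mulrA.
Qed.

Lemma base_change_scale1 : left_id 1 base_change_scale.
Proof.
apply: tensor_ext => [x y|//|m s]; first exact: base_change_scaleD.
by rewrite base_change_scale_pure mul1r.
Qed.

Lemma base_change_scaleDr : right_distributive base_change_scale +%R.
Proof. exact: base_change_scaleD. Qed.

Lemma base_change_scaleDl x : {morph base_change_scale^~ x : a b / a + b}.
Proof.
move=> a b; move: x; apply: tensor_ext => [x y|x y|m s] /=.
- exact: base_change_scaleD.
- by rewrite !base_change_scaleD addrACA.
- rewrite !base_change_scale_pure -pureDr; congr pure; exact: mulrDl.
Qed.

HB.instance Definition _ := GRing.Zmodule_isLmodule.Build S base_change
  base_change_scaleA base_change_scale1 base_change_scaleDr base_change_scaleDl.

End BaseChange.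

Section BaseChangeMap.
Context {R : comPzRingType} (S : algebra R) {M N : lmodType R}.
Context (f : {linear M -> N}).

Definition base_change_map : base_change S M -> base_change S N :=
  tensor_map f (idfun : {linear algmod S -> algmod S}).

Lemma base_change_map_linear : linear base_change_map.
Proof.
move=> a x y; rewrite /base_change_map [LHS]tensor_mapD; congr (_ + _).
move: x; apply: tensor_ext => [x x'|x x'|m s].
- by rewrite scalerDr [LHS]tensor_mapD.
- by rewrite [X in a *: X]tensor_mapD [LHS]scalerDr.
- rewrite [X in tensor_map _ _ X]base_change_scale_pure !tensor_map_pure.
  by rewrite [RHS]base_change_scale_pure.
Qed.

HB.instance Definition _ :=
  GRing.isLinear.Build S (base_change S M) (base_change S N) *:%R
    base_change_map base_change_map_linear.

End BaseChangeMap.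

Arguments base_change_map {R} S {M N} f.

Section PairKernel.
Context {R : pzRingType} {M1 M2 N : lmodType R}.
Context (f1 : {linear M1 -> N}) (f2 : {linear M2 -> N}).

Definition pair_ker : set M2 := [set m2 | exists m1 : M1, f1 m1 + f2 m2 = 0].

Lemma pair_ker_submod : subsemimod_closed [pred m2 | m2 \in pair_ker].
Proof.
split; first split.
- by apply/mem_set; exists 0; rewrite !linear0 addr0.
- move=> x y /set_mem[m e] /set_mem[m' e']; apply/mem_set; exists (m + m').
  by rewrite !linearD addrACA e e' addr0.
- move=> r x /set_mem[m e]; apply/mem_set; exists (r *: m).
  by rewrite !linearZ -scalerDr e scaler0.
Qed.

(* The submodule pair_ker as a module in its own right, with inclusion \val. *)
Record pair_ker_mod := PairKerMod {
  pair_ker_val : M2;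
  pair_ker_valP : [pred m2 | m2 \in pair_ker] pair_ker_val
}.

HB.instance Definition _ := [isSub for pair_ker_val].
HB.instance Definition _ := [Choice of pair_ker_mod by <:].
HB.instance Definition _ :=
  GRing.SubChoice_isSubLmodule.Build R M2 _ pair_ker_mod pair_ker_submod.

Definition pair_ker_incl : {linear pair_ker_mod -> M2} := \val.

End PairKernel.

(* Hence ker(f1 | f2) (x) S can be identified with its image in M2 (x) S. *)
Lemma base_change_pair_ker_inj (R : comPzRingType) (S : algebra R)
    (M1 M2 N : lmodType R) (f1 : {linear M1 -> N}) (f2 : {linear M2 -> N}) :
  flat_algebra S -> injective (base_change_map S (pair_ker_incl f1 f2)).
Proof. by apply; exact: val_inj. Qed.

(* Main.v *)
From HB Require Import structures.
Require Import Defs.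
From mathcomp Require Import all_boot all_algebra.
From mathcomp Require Import boolp classical_sets.

(** The kernel of the pair is the image under the second projection of the
    kernel of [g (m1, m2) = f1 m1 + f2 m2], so everything reduces to the
    behaviour of one kernel under [- (x) S].  If [x] and [y] satisfy
    [f1 (x) S x + f2 (x) S y = 0], then [(x, 0) + (0, y)] is killed by
    [g (x) S], and two facts describe what [g (x) S] can kill.  Right exactness
    of the tensor product ([tensor_map_surj_ker]) handles the surjection of
    [M1 * M2] onto the image of [g]: only sums of tensors [a (x) s] with
    [g a = 0] die.  Flatness handles the inclusion of this image in [N]: nothing
    more dies.  Together they give [tensor_map_flat_ker], and each
    [(m1, m2) (x) s] with [f1 m1 + f2 m2 = 0] projects to [m2 (x) s] with [m2] in
    the kernel of the pair.  The other inclusion is checked on pure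
    tensors. *)

Set Implicit Arguments.
Unset Strict Implicit.
Unset Printing Implicit Defensive.

Import GRing.Theory.
Local Open Scope ring_scope.
Local Open Scope classical_set_scope.

Section TensorKernel.
Context {R : comPzRingType} {P : lmodType R}.

Local Notation map f := (tensor_map f (idfun : {linear P -> P})).

Lemma tensor_map_comp_ext (A B C : lmodType R) (f : {linear A -> B})
    (g : {linear B -> C}) (h : {linear A -> C}) :
  (forall a, g (f a) = h a) -> forall x, map g (map f x) = map h x.
Proof.
move=> gf; elim/(@tensor_ind R A P) => [|a n x IH]; first by rewrite !linear0.
by rewrite !tensor_mapD IH !tensor_map_pure gf.
Qed.

(** Right exactness, phrased without a quotient module: the kernel of
    [p (x) P] lies in every additive subgroup [D] that contains the tensors of
    kernel elements of [p].  A set-theoretic section [q] of [p] is additive and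
    linear up to the kernel of [p], hence sends each defining relation of
    [B (x) P] to a difference in [D]. *)
Lemma tensor_map_surj_ker (A B : lmodType R) (p : {linear A -> B})
    (D : tensor A P -> Prop) :
    (forall b, exists a, p a = b) ->
    D 0 -> (forall x y, D x -> D y -> D (x - y)) ->
    (forall a n, p a = 0 -> D (pure a n)) ->
  forall x, map p x = 0 -> D x.
Proof.
move=> /choice[q qK] D0 DB Dker.
have DN x : D x -> D (- x) by rewrite -sub0r; exact: DB.
have DD x y : D x -> D y -> D (x + y).
  by move=> Dx Dy; rewrite -[y]opprK; apply: DB => //; exact: DN.
have pureB a a' n : pure (a - a') n = pure a n - pure a' n.
  by rewrite pureDl -scaleN1r pureZl scaleN1r.
have Deq a a' n : p a = p a' -> D (pure a n - pure a' n).
  by move=> e; rewrite -pureB; apply: Dker; rewrite linearB e subrr.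
pose lift (s : seq (B * P)) := \sum_(u <- s) pure (q u.1) u.2 : tensor A P.
have lift_rel s t : tensor_rel s t -> D (lift s - lift t).
  rewrite /lift; elim=> {s t}.
  - by move=> s; rewrite subrr.
  - by move=> s t _ /DN; rewrite opprB.
  - by move=> t s u _ Dst _ Dtu; have := DD _ _ Dst Dtu; rewrite addrA subrK.
  - move=> s s' t t' _ Ds _ Dt; rewrite !big_cat /= opprD addrACA.
    exact: DD.
  - by move=> s t; rewrite !big_cat /= addrC subrr.
  - by move=> n; rewrite big_seq1 big_nil subr0; apply: Dker; rewrite qK.
  - move=> m m' n; rewrite !big_cons !big_nil /= !addr0 -pureDl.
    by apply: Deq; rewrite linearD !qK.
  - by move=> m n n'; rewrite !big_cons !big_nil /= !addr0 -pureDr subrr.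
  - move=> r m n; rewrite !big_seq1 /= -pureZ_balanced.
    by apply: Deq; rewrite linearZ /= !qK.
move=> x; have [s ->] := tensor_sum x => px0.
have Ds : D (lift [seq (p u.1, u.2) | u <- s]).
  have /lift_rel : tensor_rel [seq (p u.1, u.2) | u <- s] [::].
    apply/tensor_classP; rewrite tensor_class_sum big_map.
    rewrite linear_sum /= in px0; rewrite -[RHS]px0.
    by apply: eq_bigr => u _; rewrite tensor_map_pure.
  by rewrite /lift big_nil subr0.
rewrite -[X in D X](subrK (lift [seq (p u.1, u.2) | u <- s])).
apply: (DD _ _ _ Ds); rewrite /lift big_map -sumrB.
by apply: (big_ind D D0 DD) => u _; apply: Deq; rewrite qK.
Qed.

(** Flatness removes the surjectivity assumption: [g] factors through its
    image, and the inclusion of the image stays injective after tensoring. *)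
Lemma tensor_map_flat_ker (A B : lmodType R) (g : {linear A -> B})
    (D : tensor A P -> Prop) :
    flat_module P ->
    D 0 -> (forall x y, D x -> D y -> D (x - y)) ->
    (forall a n, g a = 0 -> D (pure a n)) ->
  forall x, map g x = 0 -> D x.
Proof.
move=> flatP D0 DB Dker x gx0.
(* The image of [g] is the kernel of the pair [(g, id)]. *)
pose I := pair_ker_mod g (idfun : {linear B -> B}).
pose i : {linear I -> B} := pair_ker_incl g idfun.
have gI a : [pred b | b \in pair_ker g (idfun : {linear B -> B})] (g a).
  by apply/mem_set; exists (- a); rewrite linearN addNr.
pose c a : I := PairKerMod (gI a).
have c_lin : linear c by move=> r a b; apply: val_inj; rewrite /= linearP.
pose cL := GRing.isLinear.Build R A I *:%R c c_lin.
pose p : {linear A -> I} := HB.pack c cL.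
have pE a : i (p a) = g a by [].
apply: (@tensor_map_surj_ker _ _ p) => //.
- move=> [b bI]; have [a ab] := set_mem bI.
  exists (- a); apply: val_inj => /=; rewrite linearN.
  by apply/eqP; rewrite eq_sym -addr_eq0 addrC; apply/eqP.
- by move=> a n pa0; apply: Dker; rewrite -pE pa0 linear0.
- apply: (flatP _ _ i); first exact: val_inj.
  by rewrite (tensor_map_comp_ext pE) gx0 linear0.
Qed.

End TensorKernel.

Section PairKernelBaseChange.
Context {R : comPzRingType} {M1 M2 N : lmodType R}.
Context (f1 : {linear M1 -> N}) (f2 : {linear M2 -> N}) (S : algebra R).

Local Notation map f := (tensor_map f (idfun : {linear algmod S -> algmod S})).

Lemma base_change_pair_ker_sub :
  range (base_change_map S (pair_ker_incl f1 f2))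
    `<=` pair_ker (base_change_map S f1) (base_change_map S f2).
Proof.
move=> _ [z _ <-]; elim/(@tensor_ind R): z => [|k s z [x xz]].
  by exists 0; rewrite !linear0 addr0.
have [m mk] := set_mem (pair_ker_valP k).
exists (pure m (s : algmod S) + x : tensor M1 (algmod S)).
(* Same equations with the underlying tensor maps, where [pure] computes. *)
have {}xz : map f1 x + map f2 (map (pair_ker_incl f1 f2) z) = 0 by [].
suff : map f1 (pure m s + x) + map f2 (map (pair_ker_incl f1 f2) (pure k s + z))
  = 0 by [].
rewrite !tensor_mapD !tensor_map_pure addrACA -pureDl mk pure0l.
by rewrite xz addr0.
Qed.

Lemma flat_pair_ker_sub : flat_algebra S ->
  pair_ker (base_change_map S f1) (base_change_map S f2)
    `<=` range (base_change_map S (pair_ker_incl f1 f2)).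
Proof.
move=> flatS y [x xy0].
pose g (m : M1 * M2) := f1 m.1 + f2 m.2.
have g_lin : linear g.
  by move=> r a b; rewrite /g /= !linearP scalerDr addrACA.
pose gL := GRing.isLinear.Build R _ N *:%R g g_lin.
pose G : {linear (M1 * M2)%type -> N} := HB.pack g gL.
pose inl1 (m : M1) : M1 * M2 := (m, 0).
have inl_lin : linear inl1.
  by move=> r a b; congr pair; rewrite /= scaler0 addr0.
pose inlL := GRing.isLinear.Build R _ _ *:%R inl1 inl_lin.
pose J1 : {linear M1 -> (M1 * M2)%type} := HB.pack inl1 inlL.
pose inr1 (m : M2) : M1 * M2 := (0, m).
have inr_lin : linear inr1.
  by move=> r a b; congr pair; rewrite /= scaler0 addr0.
pose inrL := GRing.isLinear.Build R _ _ *:%R inr1 inr_lin.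
pose J2 : {linear M2 -> (M1 * M2)%type} := HB.pack inr1 inrL.
pose pr2 : {linear (M1 * M2)%type -> M2} := snd.
(* The range is pulled back to [(M1 * M2) (x) S], where the kernel of [G] lives. *)
pose D (z : tensor (M1 * M2)%type (algmod S)) :=
  exists w, map (pair_ker_incl f1 f2) w = map pr2 z.
have [w wE] : D (map J1 x + map J2 y).
  apply: (@tensor_map_flat_ker _ _ _ _ G D flatS).
  - by exists 0; rewrite !linear0.
  - move=> a b [u uE] [v vE]; exists (u - v).
    by rewrite [LHS]linearB [RHS]linearB /= uE vE.
  - move=> [m1 m2] s gm0.
    have m2K : [pred m | m \in pair_ker f1 f2] m2 by apply/mem_set; exists m1.
    by exists (pure (PairKerMod m2K) s); rewrite !tensor_map_pure.
  - rewrite tensor_mapD (@tensor_map_comp_ext _ _ _ _ _ J1 G f1); last first.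
      by move=> a; rewrite /= /g /= linear0 addr0.
    rewrite (@tensor_map_comp_ext _ _ _ _ _ J2 G f2) //.
    by move=> a; rewrite /= /g /= linear0 add0r.
exists w => //; rewrite [LHS]wE tensor_mapD.
rewrite (@tensor_map_comp_ext _ _ _ _ _ J1 pr2 (\0 : {linear M1 -> M2})) //.
rewrite (@tensor_map_comp_ext _ _ _ _ _ J2 pr2 (idfun : {linear _ -> _})) //.
have -> : map (\0 : {linear M1 -> M2}) x = 0.
  elim/(@tensor_ind R): (x) => [|m s z IH]; first by rewrite linear0.
  by rewrite tensor_mapD IH tensor_map_pure pure0l addr0.
rewrite add0r; elim/(@tensor_ind R): (y) => [|m s z IH]; first by rewrite linear0.
by rewrite tensor_mapD IH tensor_map_pure.
Qed.

End PairKernelBaseChange.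

Theorem theorem4p1 (R : comPzRingType) (M1 M2 N : lmodType R)
    (f1 : {linear M1 -> N}) (f2 : {linear M2 -> N})
    (S : algebra R) (flatS : flat_algebra S) :
  range (base_change_map S (pair_ker_incl f1 f2))
    = pair_ker (base_change_map S f1) (base_change_map S f2).
Proof.
apply/seteqP; split; first exact: base_change_pair_ker_sub.
exact: flat_pair_ker_sub.
Qed.
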